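(* Let \(\mathcal{G}\) be the group given by the presentation \[ \mathcal{G}=\langle x,y,t \mid x^7,\ y^2,\ (xy)^3,\ [x,y]^4,\ t^2,\ [t^{x^2},yx^{-1}],\ [t,y],\ (yt^{x^2})^5,\ (xyx^2t^x)^5,\ (xt)^8\rangle . \] Then \(\mathcal{G}\cong M_{22}\), the Mathieu group of degree 22. In particular, \(M_{22}\) is a homomorphic image of the progenitor \(2^{\star 14}:L_3(2)=\langle x,y,t \mid x^7, y^2, (xy)^3, [x,y]^4, t^2, [t^{x^2},yx^{-1}], [t,y]\rangle\).
   Context: Conventions: \(a^g=g^{-1}ag\) and \([a,b]=a^{-1}b^{-1}ab\). The first four relations present \(L_3(2)\) on \(x,y\). The group \(2^{\star 14}:L_3(2)\) is the semidirect product of the free product of 14 copies of the cyclic group of order 2 (generated by involutions \(t_1,\dots,t_{14}\)) by \(L_3(2)=\langle x,y\rangle\), where \(L_3(2)\) permutes the \(t_i\) according to its transitive 14-point action (the action on the cosets of a subgroup \(A_4\)), given by \(x\mapsto(1,2,3,4,5,6,7)(8,9,10,11,12,13,14)\), \(y\mapsto(1,12)(2,3)(4,11)(5,8)(6,13)(9,10)\), with \(t=t_7\); the displayed seven-relation presentation is a presentation of this semidirect product. *)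

(* Defs.v *)
From HB Require Import structures.
From mathcomp Require Import all_boot all_fingroup.

Set Implicit Arguments.
Unset Strict Implicit.
Unset Printing Implicit Defensive.


(* The Mathieu group M22, as the permutation group on 22 points generated by *)
(* the ATLAS standard generators                                             *)
(*   a = (1,13)(2,8)(3,16)(4,12)(6,22)(7,17)(9,10)(11,14)                     *)
(*   b = (1,22,3,21)(2,18,4,13)(5,12)(6,11,7,15)(8,14,20,10)(17,19)           *)
(* (points shifted to 0..21 below).  This group has order 443520 and is      *)
(* sharply 3-transitive on 22 points, i.e. it is M22.                         *)

Definition m22a_list : seq nat :=
  [:: 12; 7; 15; 11; 4; 21; 16; 1; 9; 8; 13; 3; 0; 10; 14; 2; 6; 17; 18; 19; 20; 5].
Definition m22b_list : seq nat :=
  [:: 21; 17; 20; 12; 11; 10; 14; 13; 8; 7; 6; 4; 1; 19; 5; 15; 18; 3; 16; 9; 0; 2].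

Lemma list_perm_inj (l : seq nat) :
  size l = 22 -> uniq l -> all (fun k => k < 22) l ->
  injective (fun i : 'I_22 => (inord (nth 0 l i) : 'I_22)).
Proof.
move=> sz u a i j /(congr1 val) /=.
have lt k : k < 22 -> nth 0 l k < 22 by move=> hk; apply: (all_nthP 0 a); rewrite sz.
rewrite !inordK ?lt // => /eqP; rewrite nth_uniq ?sz // => /eqP; exact: val_inj.
Qed.

Definition m22a_fun (i : 'I_22) : 'I_22 := inord (nth 0 m22a_list i).
Definition m22b_fun (i : 'I_22) : 'I_22 := inord (nth 0 m22b_list i).

Lemma m22a_inj : injective m22a_fun.
Proof. by apply: list_perm_inj. Qed.
Lemma m22b_inj : injective m22b_fun.
Proof. by apply: list_perm_inj. Qed.

Definition m22a : {perm 'I_22} := perm m22a_inj.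
Definition m22b : {perm 'I_22} := perm m22b_inj.

Local Open Scope group_scope.

Definition M22 : {group {perm 'I_22}} := <<[set m22a; m22b]>>%G.

(* Abstract (possibly infinite) groups, needed to express the universal     *)
(* property of a group presentation faithfully.                              *)

Record absGroup := AbsGroup {
  ag_car :> Type;
  ag_mul : ag_car -> ag_car -> ag_car;
  ag_one : ag_car;
  ag_inv : ag_car -> ag_car;
  ag_mulA : associative ag_mul;
  ag_mul1 : left_id ag_one ag_mul;
  ag_mulV : left_inverse ag_one ag_inv ag_mul
}.

Section AbsOps.
Variable K : absGroup.
Fixpoint ag_exp (g : K) (n : nat) : K :=
  if n is n'.+1 then @ag_mul K g (ag_exp g n') else @ag_one K.
Definition ag_conj (a g : K) : K := @ag_mul K (@ag_inv K g) (@ag_mul K a g).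
Definition ag_comm (a b : K) : K :=
  @ag_mul K (@ag_inv K a) (@ag_mul K (@ag_inv K b) (@ag_mul K a b)).

Definition progenitor_rels (x y t : K) : Prop :=
  ag_exp x 7 = @ag_one K /\
  ag_exp y 2 = @ag_one K /\
  ag_exp (@ag_mul K x y) 3 = @ag_one K /\
  ag_exp (ag_comm x y) 4 = @ag_one K /\
  ag_exp t 2 = @ag_one K /\
  ag_comm (ag_conj t (ag_exp x 2)) (@ag_mul K y (@ag_inv K x)) = @ag_one K /\
  ag_comm t y = @ag_one K.

Definition calG_rels (x y t : K) : Prop :=
  [/\ progenitor_rels x y t,
      ag_exp (@ag_mul K y (ag_conj t (ag_exp x 2))) 5 = @ag_one K,
      ag_exp (@ag_mul K x (@ag_mul K y (@ag_mul K (ag_exp x 2) (ag_conj t x)))) 5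
        = @ag_one K
    & ag_exp (@ag_mul K x t) 8 = @ag_one K].
End AbsOps.

Definition absGroup_of_fin (gT : finGroupType) : absGroup :=
  @AbsGroup gT mulg 1 invg (@mulgA gT) (@mul1g gT) (@mulVg gT).


(* [G] (a finite group H with distinguished elements x y t) is the group     *)
(* presented by generators x y t and relations [rels]:                        *)
(*  - H is generated by x y t,                                               *)
(*  - x y t satisfy [rels],                                                  *)
(*  - for every group K and elements satisfying [rels], there is a           *)
(*    homomorphism H -> K sending x y t to them (it is unique since x y t     *)
(*    generate H).                                                           *)
Definition presents (gT : finGroupType) (H : {group gT}) (x y t : gT)
    (rels : forall K : absGroup, K -> K -> K -> Prop) : Prop :=
  [/\ <<[set x; y; t]>> = H,
      rels (absGroup_of_fin gT) x y t
    & forall (K : absGroup) (x' y' t' : K), rels K x' y' t' ->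
        exists f : gT -> K,
          [/\ {in H &, forall u v, f (u * v) = @ag_mul K (f u) (f v)},
              f x = x', f y = y' & f t = t']].

(* Main.v *)
Require Import Defs.
From HB Require Import structures.
From mathcomp Require Import all_boot all_fingroup.

(* Let K be any group with elements satisfying the relations and let G be the
   product of {perm 'I_22} and K, with the three pairs of generators.  The
   subgroup of G they generate projects injectively to the first factor, so it
   is the graph of the homomorphism from M22 to K that the universal property
   asks for.

   Injectivity is climbed in two steps, 1 < <x> < L3(2) < M22.  In a step from
   N to <N, tau>, with tau an involution, one enumerates the double cosets
   N r N by a Todd-Coxeter procedure: everything is done up to left
   multiplication by N, and right multiplication by N is computed exactly
   because N is already known faithfully as a permutation group.  This needs 6
   double cosets for <x> in L3(2) (24 cosets) and 27 for L3(2) in the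
   group (2640 cosets).  Once the table is closed, every element of <N, tau> is
   a r b with a, b in N and r one of the representatives; if its permutation
   is trivial then that of r lies in N, which happens only for r = 1. *)

Set Implicit Arguments.
Unset Strict Implicit.
Unset Printing Implicit Defensive.

Declare Scope ag_scope.
Delimit Scope ag_scope with ag.
Local Notation "u * v" := (ag_mul u v) : ag_scope.
Local Notation "1" := (@ag_one _) : ag_scope.
Local Notation "u ^-1" := (ag_inv u) : ag_scope.
Local Notation "u ^+ n" := (ag_exp u n) : ag_scope.
Local Open Scope ag_scope.

(** * Calculus in an arbitrary, possibly infinite, group *)

Section AbstractGroup.
Variable G : absGroup.
Implicit Types u v w : G.

Lemma agA u v w : u * (v * w) = u * v * w. Proof. exact: ag_mulA. Qed.
Lemma ag1g u : 1 * u = u. Proof. exact: ag_mul1. Qed.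
Lemma agVg u : u^-1 * u = 1. Proof. exact: ag_mulV. Qed.

Lemma ag_mulKg u v : u^-1 * (u * v) = v.
Proof. by rewrite agA agVg ag1g. Qed.

Lemma ag_mulgI u v w : u * v = u * w -> v = w.
Proof. by move=> /(congr1 (ag_mul u^-1)); rewrite !ag_mulKg. Qed.

Lemma ag_mulgV u : u * u^-1 = 1.
Proof.
by rewrite -(ag1g (u * _)) -{1}(agVg u^-1) -agA (ag_mulKg u) agVg.
Qed.

Lemma agg1 u : u * 1 = u.
Proof. by rewrite -(agVg u) agA ag_mulgV ag1g. Qed.

Lemma ag_mulgK u v : u * v * v^-1 = u.
Proof. by rewrite -agA ag_mulgV agg1. Qed.

Lemma ag_mulgKV u v : u * v^-1 * v = u.
Proof. by rewrite -agA agVg agg1. Qed.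

Lemma ag_mulIg u v w : v * u = w * u -> v = w.
Proof. by move=> /(congr1 (fun z => z * u^-1)); rewrite !ag_mulgK. Qed.

Lemma ag_invE u v : u * v = 1 -> u^-1 = v.
Proof. by move=> uv; apply: (@ag_mulgI u); rewrite ag_mulgV. Qed.

Lemma ag_inv1 : 1^-1 = 1 :> G.
Proof. by apply: ag_invE; rewrite ag1g. Qed.

Lemma ag_invM u v : (u * v)^-1 = v^-1 * u^-1.
Proof. by apply: ag_invE; rewrite -agA (agA v) ag_mulgV ag1g ag_mulgV. Qed.

Lemma ag_expD u m n : u ^+ (m + n) = u ^+ m * u ^+ n.
Proof. by elim: m => [|m IH]; rewrite ?ag1g // addSn /= IH agA. Qed.

Lemma ag_expM u m n : u ^+ (m * n) = (u ^+ m) ^+ n.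
Proof. by elim: n => [|n IH]; rewrite ?muln0 // mulnS ag_expD IH. Qed.

Lemma ag_exp1n n : 1 ^+ n = 1 :> G.
Proof. by elim: n => //= n ->; rewrite ag1g. Qed.

Lemma ag_exp_mod u m n : u ^+ m = 1 -> u ^+ (n %% m) = u ^+ n.
Proof.
by move=> um; rewrite {2}(divn_eq n m) ag_expD mulnC ag_expM um ag_exp1n ag1g.
Qed.

Lemma ag_exp_rotate u v n : (u * v) ^+ n = 1 -> (v * u) ^+ n = 1.
Proof.
suff E : (v * u) ^+ n = u^-1 * ((u * v) ^+ n * u).
  by rewrite E => ->; rewrite ag1g agVg.
elim: n => [|n IH] /=; first by rewrite ag1g agVg.
by rewrite IH -!agA ag_mulKg (agA u u^-1) ag_mulgV ag1g.
Qed.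

Lemma ag_commP u v : ag_comm u v = 1 -> u * v = v * u.
Proof. move=> uv; apply: (@ag_mulgI v^-1); apply: (@ag_mulgI u^-1).
by rewrite -[LHS]/(ag_comm u v) uv ag_mulKg agVg. Qed.

(** Conjugation by [v^-1] frees [u]: the relation [[t^(x^2), yx^-1]] thus becomes a statement about
    which element of L3(2) commutes with [t]. *)
Lemma ag_comm_conj u v w : ag_comm (ag_conj u v) w = 1 ->
  v * w * v^-1 * u = u * (v * w * v^-1).
Proof.
move/ag_commP => E; have Eu : u = v * ag_conj u v * v^-1.
  by rewrite /ag_conj (agA v) ag_mulgV ag1g ag_mulgK.
move: (ag_conj u v) E Eu => s E ->.
by rewrite !agA !ag_mulgKV -(agA v w) -(agA v s) E.

Qed.

(** Words grow on the right only, by a factor from [N] or by [tau], which is how the coset table is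
    acted on. For an involution [tau] and a subgroup [N] this is the subgroup they generate. *)
Inductive adjoin (N : G -> Prop) (tau : G) : G -> Prop :=
| adjoin1 : adjoin N tau 1
| adjoinM u v : adjoin N tau u -> N v -> adjoin N tau (u * v)
| adjoin_gen u : adjoin N tau u -> adjoin N tau (u * tau).

Lemma adjoin_mul N tau u v :
  adjoin N tau u -> adjoin N tau v -> adjoin N tau (u * v).
Proof.
move=> Du; elim=> [|v1 v2 _ Dv Nv|v1 _ Dv]; first by rewrite agg1.
  by rewrite agA; apply: adjoinM.
by rewrite agA; apply: adjoin_gen.
Qed.

Lemma adjoin_sub (N : G -> Prop) tau v : N v -> adjoin N tau v.
Proof. by move=> Nv; rewrite -(ag1g v); apply: adjoinM => //; apply: adjoin1. Qed.

Lemma adjoin_tau N tau : adjoin N tau tau.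
Proof. by rewrite -{2}(ag1g tau); apply: adjoin_gen; apply: adjoin1. Qed.

Lemma adjoin_inv (N : G -> Prop) tau u : tau * tau = 1 ->
  (forall v, N v -> N v^-1) -> adjoin N tau u -> adjoin N tau u^-1.
Proof.
move=> t2 NV; elim=> [|v1 v2 _ Dv Nv|v1 _ Dv]; first by rewrite ag_inv1; apply: adjoin1.
  by rewrite ag_invM; apply: adjoin_mul => //; apply/adjoin_sub/NV.
rewrite ag_invM (ag_invE t2); apply: adjoin_mul => //; exact: adjoin_tau.
Qed.
End AbstractGroup.

(** * Double coset enumeration *)

(* Permutations of {0, ..., n-1} as lists of images; cmul p q is p followed by q. *)
Definition code := seq nat.
Definition cmul (p q : code) : code := [seq nth 0 q i | i <- p].
Definition cinv (p : code) : code := [seq index i p | i <- iota 0 (size p)].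

(* The node (c, p) stands for the coset N r_c p. *)
Definition node := (nat * code)%type.

Section Enumeration.
(* els lists the elements of N, and B elements of N commuting with tau.  A
   relator [:: p1; ...; pk] stands for tau p1 tau p2 ... tau pk = 1. *)
Variables (els : seq code) (idc : code) (B : seq code) (rels : seq (seq code)).

(* An entry (p, b) of row c records that tau maps the node (c, p) to b; stabs
   lists, for each c, elements s of N with N r_c s = N r_c. *)
Record table := Table { rows : seq (seq (code * node)); stabs : seq (seq code) }.

Fixpoint assoc (p : code) (r : seq (code * node)) : option node :=
  if r is (n, b) :: r' then if n == p then Some b else assoc p r' else None.

(** If [s] fixes the coset [N r_c], then [(c, p)] and [(c, sp)] stand for the same coset, so an
    entry under any key [sp] serves for [p]. *)
Fixpoint first_assoc (ss : seq code) (p : code) r : option node :=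
  if ss is s :: ss' then
    if assoc (cmul s p) r is Some b then Some b else first_assoc ss' p r
  else None.

Definition lookup (T : table) (q : node) : option node :=
  first_assoc (nth [::] (stabs T) q.1) q.2 (nth [::] (rows T) q.1).

Definition push (r : seq (seq (code * node))) (a b : node) :=
  set_nth [::] r a.1 ((a.2, b) :: nth [::] r a.1).

Definition shift (a : node) (p : code) : node := (a.1, cmul a.2 p).

(** As [B] commutes with [tau], one entry yields its translates by [B], in both directions because
    [tau] is an involution. The entry itself is recorded through the identity, which both lists used
    for [B] contain. *)
Definition add_edge (T : table) (a b : node) : table :=
  Table (foldl (fun r p => push (push r (shift a p) (shift b p))
                                (shift b p) (shift a p)) (rows T) B)
        (stabs T).

(** Closure under products by repeated squaring of the set. Soundness asks only that every listed
    element fix the coset, so the list may stop short of the full stabiliser. *)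
Fixpoint span (fuel : nat) (S : seq code) : seq code :=
  if fuel is k.+1 then
    let S' := undup [seq cmul p q | p <- S, q <- S] in
    if size S' == size S then S else span k S'
  else S.

(** [N r_c p = N r_c q] puts [p q^-1] in the stabiliser of [N r_c]. Coincidences between different
    representatives are dropped: double cosets are never merged. *)
Definition coincide (T : table) (a b : node) : table :=
  if a.1 == b.1 then
    let S := nth [::] (stabs T) a.1 in
    let p := cmul a.2 (cinv b.2) in
    if p \in S then T else Table (rows T) (set_nth [::] (stabs T) a.1 (span 5 (p :: S)))
  else T.

Fixpoint forward (T : table) (a : node) (l : seq code) : node * seq code :=
  if l is n :: l' then
    if lookup T a is Some b then forward T (shift b n) l' else (a, l)
  else (a, [::]).

(** The relator comes reversed; each step undoes an element of [N], then [tau]. The leading [tau] is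
    left undone, since it is the missing entry. *)
Fixpoint backward (T : table) (b : node) (l : seq code) : option node :=
  if l is n :: l' then
    let b' := shift b (cinv n) in
    if l' is [::] then Some b'
    else if lookup T b' is Some a then backward T a l' else None
  else None.

(* Traces a relator from a node in both directions: a single gap left in the
   middle gives a new entry, no gap gives a coincidence. *)
Definition scan (T : table) (s : nat * nat * nat) : table :=
  let: (c, i, k) := s in
  let a := (c, nth idc els i) in
  let: (f, l) := forward T a (nth [::] rels k) in
  if l is [::] then coincide T f a
  else if backward T a (rev l) is Some b then add_edge T f b else T.

(* The pair (d, i) at position c - 1 defines r_c as r_d p tau, where p is the
   i-th element of N; a representative is kept as the list of these p. *)
Definition coset_reps (defs : seq (nat * nat)) : seq (seq code) :=
  foldl (fun r d => rcons r (rcons (nth [::] r d.1) (nth idc els d.2))) [:: [::]] defs.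

(** The test makes the entry true by definition of [r_c], with no appeal to how the list [R] was
    built. *)
Definition define (R : seq (seq code)) (T : table) (e : nat * (nat * nat)) : table :=
  let: (c, (d, i)) := e in
  let p := nth idc els i in
  if nth [::] R c == rcons (nth [::] R d) p then add_edge T (d, p) (c, idc) else T.

Definition enumerate (R : seq (seq code)) (defs : seq (nat * nat))
    (steps : seq (nat * nat * nat)) : table :=
  let T0 := Table [::] (els :: nseq (size defs) [:: idc]) in
  let T1 := foldl (define R) T0 (zip (iota 1 (size defs)) defs) in
  foldl scan T1 steps.

Definition closed_table (m : nat) (T : table) : bool :=
  all (fun c => all (fun p => if lookup T (c, p) is Some b then b.1 < m else false) els)
      (iota 0 m).

Definition rep_code (tc : code) (l : seq code) : code :=
  foldl (fun p n => cmul (cmul p n) tc) idc l.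

Definition certified (tc : code) (defs : seq (nat * nat))
    (steps : seq (nat * nat * nat)) : bool :=
  let R := coset_reps defs in
  [&& nth [::] R 0 == [::], closed_table (size R) (enumerate R defs steps)
    & all (fun l => all (mem els) l &&
                    ((l == [::]) || (rep_code tc l \notin els))) R].

#[local] Arguments span : simpl never.

(** * Soundness: table entries are true equalities of cosets in [G] *)

Section Soundness.
Variables (G : absGroup) (el : code -> G) (tau : G).
Hypothesis id_els : idc \in els.
Hypothesis el1 : el idc = 1.
Hypothesis elM : {in els &, forall p q,
  cmul p q \in els /\ el (cmul p q) = el p * el q}.
Hypothesis elV : {in els, forall p, cinv p \in els /\ el (cinv p) = (el p)^-1}.
Hypothesis tau2 : tau * tau = 1.
Hypothesis B_comm : {in B, forall p, p \in els /\ el p * tau = tau * el p}.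

Definition rel_word (l : seq code) : G := foldr (fun p u => tau * (el p * u)) 1 l.
Hypothesis relsP : {in rels, forall l, {subset l <= els} /\ rel_word l = 1}.

Definition rep_word (l : seq code) : G := foldl (fun u p => u * el p * tau) 1 l.
Variable R : seq (seq code).
Definition rep (c : nat) : G := rep_word (nth [::] R c).
Hypothesis rep0 : rep 0 = 1.

Definition same_coset (u v : G) : Prop := exists2 p, p \in els & u = el p * v.

Lemma same_coset_refl u : same_coset u u.
Proof. by exists idc => //; rewrite el1 ag1g. Qed.

Lemma same_coset_sym u v : same_coset u v -> same_coset v u.
Proof.
by case=> p /elV[pV E] ->; exists (cinv p) => //; rewrite E ag_mulKg.
Qed.

Lemma same_coset_trans v u w : same_coset u v -> same_coset v w -> same_coset u w.
Proof.
case=> p pe -> [q qe ->]; have [pq E] := elM pe qe.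
by exists (cmul p q) => //; rewrite E agA.
Qed.

Lemma same_cosetMr w u v : same_coset u v -> same_coset (u * w) (v * w).
Proof. by case=> p pe ->; exists p => //; rewrite agA. Qed.

Definition nval (a : node) : G := rep a.1 * el a.2.
Definition valid (a : node) : Prop := a.2 \in els.

Lemma nval_shift a p : valid a -> p \in els ->
  valid (shift a p) /\ nval (shift a p) = nval a * el p.
Proof. by move=> oa op; have [ok E] := elM oa op; rewrite /nval /= E agA. Qed.

Lemma nval_shiftV a p : valid a -> p \in els ->
  valid (shift a (cinv p)) /\ nval (shift a (cinv p)) = nval a * (el p)^-1.
Proof. by move=> oa /elV[op E]; have := nval_shift oa op; rewrite E. Qed.

Definition good_edge (a b : node) : Prop :=
  [/\ valid a, valid b & same_coset (nval a * tau) (nval b)].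

Definition good_rows (r : seq (seq (code * node))) : Prop :=
  forall c e, e \in nth [::] r c -> good_edge (c, e.1) e.2.

Definition good_stab (c : nat) (p : code) : Prop :=
  p \in els /\ same_coset (rep c * el p) (rep c).

Definition good (T : table) : Prop :=
  good_rows (rows T) /\ forall c p, p \in nth [::] (stabs T) c -> good_stab c p.

Lemma good_edge_sym a b : good_edge a b -> good_edge b a.
Proof.
case=> oa ob ab; split=> //; apply: same_coset_sym.
by have := same_cosetMr tau ab; rewrite -agA tau2 agg1.
Qed.

Lemma good_edge_shift a b p :
  good_edge a b -> p \in B -> good_edge (shift a p) (shift b p).
Proof.
case=> oa ob ab /B_comm[pe pt].
have [oap Ea] := nval_shift oa pe; have [obp Eb] := nval_shift ob pe.
by split=> //; rewrite Ea Eb -agA pt agA; apply: same_cosetMr.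
Qed.

Lemma good_push r a b : good_rows r -> good_edge a b -> good_rows (push r a b).
Proof.
move=> gr ab c e; rewrite /push nth_set_nth /=.
case: eqP => [->|_]; last exact: gr.
by rewrite inE => /orP[/eqP->|/gr//]; case: a ab.
Qed.

Lemma good_add_edge T a b : good T -> good_edge a b -> good (add_edge T a b).
Proof.
case=> gr gs ab; split=> //=; move: (rows T) gr.
have: {subset B <= B} by [].
(* Only the folded list varies; the fixed [B] on the right of the inclusion keeps its elements
   eligible for [good_edge_shift]. *)
elim: {1 3}B => //= p l IH sB r gr.
apply: IH => [q ql|]; first by apply: sB; rewrite inE ql orbT.
have ok : good_edge (shift a p) (shift b p).
  by apply: good_edge_shift => //; apply: sB; rewrite mem_head.
by apply: good_push; [apply: good_push | apply: good_edge_sym].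
Qed.

Lemma assoc_mem p r b : assoc p r = Some b -> (p, b) \in r.
Proof.
elim: r => //= -[n b'] r IH; case: eqP => [-> [->]|_ /IH]; rewrite inE ?eqxx //.
by move=> ->; rewrite orbT.
Qed.

Lemma lookupP T a b : good T -> valid a -> lookup T a = Some b -> good_edge a b.
Proof.
case=> gr gs oa; rewrite /lookup.
have: forall s, s \in nth [::] (stabs T) a.1 -> good_stab a.1 s by exact: gs.
elim: (nth _ _ _) => //= s ss IH ok.
case E: (assoc _ _) => [b'|]; last first.
  by apply: IH => s' s's; apply: ok; rewrite inE s's orbT.
case=> <-; have [se sR] := ok s (mem_head _ _).
have [_ ob ab] := gr _ _ (assoc_mem E); split=> //.
apply: same_coset_trans ab; apply: same_cosetMr; rewrite /nval /=.
by have [_ ->] := elM se oa; rewrite agA; apply: same_cosetMr; apply: same_coset_sym.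
Qed.

Lemma good_span k c S : {in S, forall p, good_stab c p} ->
  {in span k S, forall p, good_stab c p}.
Proof.
elim: k S => [|k IH] S gS //; rewrite /span -/span; case: ifP => // _; apply: IH => p.
rewrite mem_undup => /allpairsP[[p1 p2] /= [/gS[e1 s1] /gS[e2 s2] ->]].
have [ee E] := elM e1 e2; split=> //; rewrite E agA.
exact: same_coset_trans (same_cosetMr _ s1) s2.
Qed.

Lemma good_coincide T a b : good T -> valid a -> valid b ->
  same_coset (nval a) (nval b) -> good (coincide T a b).
Proof.
rewrite /coincide => gT oa ob ab; case: eqP => // ceq; case: ifP => // _.
split=> [|c p]; first by case: gT.
rewrite [stabs _]/(set_nth _ _ _ _) nth_set_nth /=.
case: eqP => [->|_]; last by case: gT => _; apply.
suff gS : {in cmul a.2 (cinv b.2) :: nth [::] (stabs T) a.1,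
             forall q, good_stab a.1 q} by move/(good_span gS).
move=> q; rewrite inE => /orP[/eqP->|]; last by case: gT => _; apply.
have [obV EV] := elV ob; have [ok E] := elM oa obV; split=> //.
rewrite E EV agA; have := same_cosetMr (el b.2)^-1 ab; rewrite /nval -ceq.
by rewrite ag_mulgK.
Qed.

(** The coset of the current node times the unread part of the relator is invariant along the
    trace. *)
Lemma forwardP T a l f r : good T -> valid a -> {subset l <= els} ->
  forward T a l = (f, r) ->
  [/\ valid f, {subset r <= els}
    & same_coset (nval a * rel_word l) (nval f * rel_word r)].
Proof.
move=> gT; elim: l a => /= [|n l IH] a oa sl.
  by case=> <- <-; split=> //; apply: same_coset_refl.
have ne : n \in els by apply: sl; rewrite mem_head.
have sl' : {subset l <= els} by move=> p pl; apply: sl; rewrite inE pl orbT.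
case E: (lookup T a) => [b|]; last by case=> <- <-; split=> //; apply: same_coset_refl.
have [_ ob ab] := lookupP gT oa E; have [obn Eb] := nval_shift ob ne.
case/(IH _ obn sl') => of_ sr fr; split=> //; apply: same_coset_trans fr.
by rewrite Eb !agA; do 2 apply: same_cosetMr.
Qed.

Lemma rel_word_rcons l n : rel_word (rcons l n) = rel_word l * tau * el n.
Proof. by elim: l => /= [|p l ->]; rewrite ?agg1 ?ag1g ?agA. Qed.

(** The hypothesis relating [f] to [b] is the loop invariant. Stripping the last [tau p] preserves
    it, and with a single pair left it is the edge itself. *)
Lemma backwardP T f b l b' : good T -> valid f -> valid b -> {subset l <= els} ->
  same_coset (nval f * rel_word (rev l)) (nval b) ->
  backward T b l = Some b' -> good_edge f b'.
Proof.
move=> gT of_; elim: l b => //= n l IH b ob sl.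
have ne : n \in els by apply: sl; rewrite mem_head.
have sl' : {subset l <= els} by move=> p pl; apply: sl; rewrite inE pl orbT.
have [obn Eb] := nval_shiftV ob ne.
rewrite rev_cons rel_word_rcons !agA => fb.
have {}fb : same_coset (nval f * rel_word (rev l) * tau) (nval (shift b (cinv n))).
  by rewrite Eb; have := same_cosetMr (el n)^-1 fb; rewrite ag_mulgK.
case: l IH sl' fb {sl} => [|n' l] IH sl' fb.
  by case=> <-; split; rewrite // -(agg1 (nval f)).
case E: (lookup _ _) => [a|] //; have [_ oa ba] := lookupP gT obn E.
apply: IH => //; apply: same_coset_trans ba.
by have := same_cosetMr tau fb; rewrite -2!agA tau2 agg1.
Qed.

(** The default [idc] makes every index legal, so the enumeration data need no range check. *)
Lemma els_nth i : nth idc els i \in els.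
Proof. by case: (ltnP i (size els)) => [/mem_nth->//|/(nth_default idc)->]. Qed.

Lemma good_scan T s : good T -> good (scan T s).
Proof.
case: s => [[c i] k] gT; rewrite /scan.
have oa : valid (c, nth idc els i) by apply: els_nth.
have [sl El] : {subset nth [::] rels k <= els} /\ rel_word (nth [::] rels k) = 1.
  case: (ltnP k (size rels)) => [/(mem_nth [::])/relsP//|/(nth_default [::])->].
  by [].
case E: (forward _ _ _) => [f l]; have [of_ sr] := forwardP gT oa sl E.
rewrite El agg1; case: l sr {E} => [|n l] sr fa.
  (* The relator was read completely from [a] to [f]; being trivial, it makes both nodes name one
     coset. *)
  by apply: good_coincide => //; apply: same_coset_sym; rewrite /= agg1 in fa.
case E: (backward _ _ _) => [b|] //; apply: good_add_edge => //.
apply: (backwardP gT of_ oa _ _ E) => [p|]; first by rewrite mem_rev => /sr.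
by rewrite revK; apply: same_coset_sym.
Qed.

Lemma good_define T e : good T -> good (define R T e).
Proof.
case: e => [c [d i]] gT; rewrite /define; case: eqP => // E.
apply: good_add_edge => //; split=> //=; first exact: els_nth.
rewrite /nval /= el1 agg1 /rep E /rep_word foldl_rcons; exact: same_coset_refl.
Qed.

Lemma good_enumerate defs steps : good (enumerate R defs steps).
Proof.
rewrite /enumerate; set T0 := Table _ _.
have: good T0.
  split=> [c e|[|c] p] /=; first by rewrite nth_nil.
    (* All of [N] fixes the coset [N r_0], because [r_0 = 1]. *)
    by move=> pe; split=> //; exists p; rewrite ?rep0 ?ag1g ?agg1.
  rewrite nth_nseq; case: ifP => // _; rewrite inE => /eqP->.
  by split=> //; rewrite el1 agg1; apply: same_coset_refl.
move: T0; elim: (zip _ _) => /= [|e l IH] T gT; last exact/IH/good_define.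
by elim: steps T gT => //= s l IH T gT; apply/IH/good_scan.
Qed.

(** The form [p r_c q] survives right multiplication: a factor from [N] is absorbed in [q], while
    [tau] is carried through by the entry for [(c, q)], whose left factor from [N] is absorbed in
    [p]. *)
Lemma adjoin_cover m T u : good T -> 0 < m -> closed_table m T ->
  adjoin (fun g => exists2 p, p \in els & g = el p) tau u ->
  exists c p q, [/\ c < m, p \in els, q \in els & u = el p * rep c * el q].
Proof.
move=> gT m0 /allP cT; elim=> [|u1 _ _ [c [p [q [cm pe qe ->]]]] [r re ->]|
  u1 _ [c [p [q [cm pe qe ->]]]]].
- by exists 0, idc, idc; split=> //; rewrite rep0 el1 !ag1g.
- have [qr E] := elM qe re; exists c, p, (cmul q r); split=> //.
  by rewrite E agA.
have /cT/allP/(_ q qe) : c \in iota 0 m by rewrite mem_iota.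
case E: (lookup _ _) => [b|] // bm.
have [_ ob [r re Eb]] := lookupP (a := (c, q)) gT qe E.
have [pr Epr] := elM pe re.
exists b.1, (cmul p r), b.2; split=> //.
by rewrite Epr -!agA; congr (_ * _); rewrite !agA in Eb *.
Qed.

End Soundness.
End Enumeration.

(** * One step of the climb: faithfulness passes from [N] to [<N, tau>] *)

Section Stage.
Variables (G : absGroup) (cd : G -> code).
Hypothesis cdM : forall u v, cd (u * v) = cmul (cd u) (cd v).
Hypothesis cdV : forall u, cd u^-1 = cinv (cd u).
Variable N : G -> Prop.
Hypothesis N1 : N 1.
Hypothesis NM : forall u v, N u -> N v -> N (u * v).
Hypothesis NV : forall u, N u -> N u^-1.
Hypothesis Ninj : forall u, N u -> cd u = cd 1 -> u = 1.
Variables (els : seq code) (el : code -> G).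
Hypothesis N_el : forall p, N (el p).
Hypothesis cd_el : {in els, forall p, cd (el p) = p}.
Hypothesis els_cd : forall u, N u -> cd u \in els.

Lemma cd_inj u v : N u -> N v -> cd u = cd v -> u = v.
Proof.
move=> Nu Nv E; apply: (@ag_mulIg _ v^-1); rewrite ag_mulgV.
by apply: Ninj; [apply/NM/NV | rewrite cdM E -cdM ag_mulgV].
Qed.

Lemma el_cd u : N u -> el (cd u) = u.
Proof. by move=> Nu; apply: cd_inj => //; rewrite cd_el // els_cd. Qed.

Variables (tau : G) (B : seq code) (rels : seq (seq code)).
Hypothesis tau2 : tau * tau = 1.
Hypothesis B_comm : {in B, forall p, exists u, [/\ N u, cd u = p & u * tau = tau * u]}.
Hypothesis relsP :
  {in rels, forall l, {subset l <= els} /\ rel_word el tau l = 1}.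
Variables (defs : seq (nat * nat)) (steps : seq (nat * nat * nat)).
Hypothesis cert : certified els (cd 1) B rels (cd tau) defs steps.

Lemma adjoin_cd_inj u : adjoin N tau u -> cd u = cd 1 -> u = 1.
Proof.
have el1 : el (cd 1) = 1 by apply: el_cd.
have elM : {in els &, forall p q,
    cmul p q \in els /\ el (cmul p q) = el p * el q}.
  move=> p q pe qe; have NN : N (el p * el q) by apply: NM.
  have -> : cmul p q = cd (el p * el q) by rewrite cdM !cd_el.
  by rewrite els_cd ?el_cd.
have elV : {in els, forall p, cinv p \in els /\ el (cinv p) = (el p)^-1}.
  move=> p pe; have NN : N (el p)^-1 by apply: NV.
  have -> : cinv p = cd (el p)^-1 by rewrite cdV cd_el.
  by rewrite els_cd ?el_cd.
have Bc : {in B, forall p, p \in els /\ el p * tau = tau * el p}.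
  by move=> p /B_comm[v [Nv <- E]]; rewrite els_cd ?el_cd.
case/and3P: cert => /eqP R0 cT /allP Rok Nu cdu.
have rep0 : rep el tau (coset_reps els (cd 1) defs) 0 = 1 by rewrite /rep R0.
have gT := good_enumerate (els_cd N1) el1 elM elV tau2 Bc relsP rep0 defs steps.
have Rgt : 0 < size (coset_reps els (cd 1) defs).
  rewrite /coset_reps; elim/last_ind: (defs) => // l d _.
  by rewrite foldl_rcons size_rcons.
have Nu' : adjoin (fun g => exists2 p, p \in els & g = el p) tau u.
  elim: {cdu} Nu => [|u1 u2 _ D Nu2|u1 _ D]; first exact: adjoin1.
    by apply: adjoinM => //; exists (cd u2); rewrite ?els_cd ?el_cd.
  exact: adjoin_gen.
have [c [p [q [cm pe qe Eu]]]] :=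
  adjoin_cover (els_cd N1) el1 elM elV rep0 gT Rgt cT Nu'.
have /Rok/andP[/allP lR] := mem_nth [::] cm.
have cdR : cd (rep el tau (coset_reps els (cd 1) defs) c) =
           rep_code (cd 1) (cd tau) (nth [::] (coset_reps els (cd 1) defs) c).
  rewrite /rep; move: (nth _ _ _) lR => l; elim/last_ind: l => //= l r IH lR.
  rewrite /rep_word /rep_code !foldl_rcons !cdM cd_el; last first.
    by apply: lR; rewrite mem_rcons mem_head.
  rewrite -/(rep_word el tau l) IH // => s sl.
  by apply: lR; rewrite mem_rcons inE sl orbT.
have Epq : N (el p * el q) by apply: NM.
case/orP => [/eqP l0|/negP[]].
  move: Eu; rewrite /rep l0 /= agg1 => Eu; move: cdu; rewrite Eu; exact: Ninj.
rewrite -cdR.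
(* As [cd u] is trivial, the representative has the code of [p^-1 q^-1], which lies in [els],
   against the certificate. *)
have -> : rep el tau (coset_reps els (cd 1) defs) c = (el p)^-1 * u * (el q)^-1.
  by rewrite Eu -!agA ag_mulgV agg1 ag_mulKg.
rewrite 2!cdM cdu -2!cdM; apply: els_cd.
by apply: NM; [apply: NM => //; apply: NV | apply: NV].
Qed.
End Stage.

(** * Permutation codes, products and words *)

Section PermCode.
Variable n : nat.
Implicit Types p q : {perm 'I_n}.

Definition pcode p : code := [seq val (p i) | i <- enum 'I_n].

Lemma nth_pcode p (i : 'I_n) : nth 0 (pcode p) i = p i.
Proof. by rewrite /pcode (nth_map i 0 _) ?size_enum_ord // nth_ord_enum. Qed.

Lemma pcode_inj : injective pcode.
Proof. by move=> p q E; apply/permP => i; apply: val_inj; rewrite /= -!nth_pcode E. Qed.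

Lemma pcodeM p q : pcode (p * q)%g = cmul (pcode p) (pcode q).
Proof. by rewrite /cmul -map_comp; apply: eq_map => i /=; rewrite nth_pcode permM. Qed.

Lemma pcode1 : pcode 1%g = iota 0 n.
Proof. by rewrite -val_enum_ord; apply: eq_map => i; rewrite perm1. Qed.

Lemma pcodeV p : pcode p^-1%g = cinv (pcode p).
Proof.
rewrite /cinv size_map size_enum_ord -val_enum_ord -map_comp.
apply: eq_map => i /=; rewrite -{2}(permKV p i).
rewrite (index_map (f := fun j => val (p j))) ?index_enum_ord //.
by move=> j k /val_inj/perm_inj.
Qed.
End PermCode.

Lemma pcode_list (l : seq nat) (f : 'I_22 -> 'I_22) (fI : injective f) :
  size l = 22 -> all (fun k => k < 22) l ->
  f =1 (fun i : 'I_22 => inord (nth 0 l i)) -> pcode (perm fI) = l.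
Proof.
move=> sz al fE; apply: (@eq_from_nth _ 0) => [|i];
  rewrite size_map size_enum_ord ?sz // => i22.
rewrite (nth_pcode _ (Ordinal i22)) permE fE inordK //.
by apply: (all_nthP 0 al); rewrite sz.
Qed.

Lemma pcode_m22a : pcode m22a = m22a_list.
Proof. exact: pcode_list. Qed.

Lemma pcode_m22b : pcode m22b = m22b_list.
Proof. exact: pcode_list. Qed.

(** * Direct products of groups *)

Section ProductGroup.
Variables G H : absGroup.

Definition prod_group : absGroup.
Proof.
refine (@AbsGroup (G * H)%type (fun u v => (u.1 * v.1, u.2 * v.2))
  (1, 1) (fun u => (u.1^-1, u.2^-1)) _ _ _).
- by move=> u v w; rewrite !agA.
- by case=> u v; rewrite !ag1g.
- by move=> u; rewrite !agVg.
Defined.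

Lemma prod_eq1 (w : prod_group) : w.1 = 1 -> w.2 = 1 -> w = 1.
Proof. by case: w => u v /= -> ->. Qed.

Lemma prod_calG_rels (x y t : G) (x' y' t' : H) :
  calG_rels x y t -> calG_rels x' y' t' ->
  @calG_rels prod_group (x, x') (y, y') (t, t').
Proof.
case=> [[r1 [r2 [r3 [r4 [r5 [r6 r7]]]]]] r8 r9 r10].
case=> [[s1 [s2 [s3 [s4 [s5 [s6 s7]]]]]] s8 s9 s10].
(* All exponents are numerals, so each coordinate of a relator computes to the relator in that
   factor. *)
split; [do 6?split | | |]; exact: prod_eq1.
Qed.
End ProductGroup.

(** * Words in the generators *)

Inductive letter := X | Y | T.
Lemma letter_comparable : comparable letter.
Proof. by case; case; (left + right). Qed.
HB.instance Definition _ := hasDecEq.Build letter (compareP letter_comparable).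

Definition not_t (l : letter) : bool := if l is T then false else true.

Definition word := seq letter.

Section Words.
Variables (G : absGroup) (x y t : G).

Definition letter_val (l : letter) : G :=
  match l with X => x | Y => y | T => t end.

Definition eval (w : word) : G := foldr (fun l u => letter_val l * u) 1 w.

Lemma eval_cat v w : eval (v ++ w) = eval v * eval w.
Proof. by elim: v => [|l v IH] /=; rewrite ?ag1g // IH agA. Qed.

Lemma eval_nseq l n : eval (nseq n l) = letter_val l ^+ n.
Proof. by elim: n => //= n ->. Qed.
End Words.

(** The relations [x^7 = y^2 = t^2 = 1] make inverses positive words, so the alphabet has no inverse
    letters. *)
Definition inv_letter (l : letter) : word :=
  match l with X => nseq 6 X | Y => [:: Y] | T => [:: T] end.

Definition inv_word (w : word) : word := flatten (rev (map inv_letter w)).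

Lemma eval_inv (G : absGroup) (x y t : G) w :
  x ^+ 7 = 1 -> y ^+ 2 = 1 -> t ^+ 2 = 1 ->
  eval x y t (inv_word w) = (eval x y t w)^-1.
Proof.
move=> x7 y2 t2; have lV l : eval x y t (inv_letter l) = (letter_val x y t l)^-1.
  by apply/esym/ag_invE; case: l.
elim: w => [|l w IH]; first by rewrite ag_inv1.
rewrite /inv_word /= rev_cons flatten_rcons eval_cat lV ag_invM.
by rewrite -IH.
Qed.

Section RelWord.
Variables (G : absGroup) (el : code -> G) (tau : G).

Lemma rel_word_cat l1 l2 :
  rel_word el tau (l1 ++ l2) = rel_word el tau l1 * rel_word el tau l2.
Proof. by elim: l1 => [|p l IH] /=; rewrite ?ag1g // IH !agA. Qed.

Lemma rel_word_flatten n l :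
  rel_word el tau (flatten (nseq n l)) = rel_word el tau l ^+ n.
Proof. by elim: n => //= n IH; rewrite rel_word_cat IH. Qed.
End RelWord.

(** * Permutation images of the generators and data of the enumerations *)

Local Open Scope nat_scope.

Definition xcode : code :=
  [:: 7; 14; 5; 20; 17; 13; 11; 19; 21; 8; 9; 4; 0; 10; 12; 15; 6; 3; 1; 18;
   16; 2].
Definition ycode : code := m22a_list.
Definition tcode : code :=
  [:: 5; 13; 3; 2; 4; 0; 9; 10; 16; 6; 7; 15; 21; 1; 14; 11; 8; 17; 18; 19;
   20; 12].
Definition idcode : code := iota 0 22.

Definition letter_code (l : letter) : code :=
  match l with X => xcode | Y => ycode | T => tcode end.
Definition word_code (w : word) : code :=
  foldr (fun l p => cmul (letter_code l) p) idcode w.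

Definition els_C7 : seq code := [seq word_code (nseq i X) | i <- iota 0 7].
(* (yx)^3 and (y x y x^-1)^4, the latter being [x,y]^4 up to rotation *)
Definition rels_C7 : seq (seq code) :=
  let c i := word_code (nseq i X) in
  [:: flatten (nseq 3 [:: c 1]); flatten (nseq 4 [:: c 1; c 6])].

(* x^i r with r in a transversal of <x> in L3(2), read off the first enumeration *)
Definition words_L32 : seq word :=
  let a := rcons (nseq 6 X) Y in
  let b := a ++ rcons (nseq 2 X) Y in
  let c := b ++ rcons (nseq 4 X) Y in
  let d := b ++ rcons (nseq 6 X) Y in
  let e := d ++ rcons (nseq 4 X) Y in
  let orbit w := [seq w ++ nseq j X | j <- iota 0 7] in
  let transversal := [::] :: orbit a ++ orbit b ++ c :: orbit d ++ [:: e] in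
  [seq nseq i X ++ w | w <- transversal, i <- iota 0 7].
Definition els_L32 : seq code := map word_code words_L32.
(* (yt^(x^2))^5, (xyx^2t^x)^5 and (xt)^8, rotated so as to start with t *)
Definition rels_L32 : seq (seq code) :=
  [:: flatten (nseq 5 [:: word_code (nseq 2 X ++ Y :: nseq 5 X)]);
      flatten (nseq 5 [:: word_code [:: X; X; Y; X]]);
      flatten (nseq 8 [:: word_code [:: X]])].
(* The centraliser A4 of t in L3(2): it is generated by y and
   z = x^2 y x^-3, on which the relation [t^(x^2), yx^-1] bears. *)
Definition words_A4 : seq word :=
  let z i := flatten (nseq i (nseq 2 X ++ Y :: nseq 4 X)) in
  map z (iota 0 3) ++ [seq z i ++ Y :: z j | i <- iota 0 3, j <- iota 0 3].

(* The order of definitions and the scans (double coset, element of N, relator)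
   come from a computer search. *)
Definition defs_L32 : seq (nat * nat) :=
  [:: (0, 6); (1, 2); (2, 4); (2, 6); (4, 4)].

Definition steps_L32 : seq (nat * nat * nat) :=
  [:: (0, 0, 0); (1, 2, 0); (0, 0, 1); (1, 3, 0); (1, 5, 0); (2, 3, 0); (3, 0,
   0); (4, 3, 0); (1, 2, 1); (5, 1, 0)].

Definition defs_M22 : seq (nat * nat) :=
  [:: (0, 0); (1, 1); (1, 23); (2, 23); (2, 1); (2, 18); (5, 23); (5, 7); (2,
   15); (9, 1); (6, 16); (10, 7); (7, 3); (5, 1); (2, 4); (2, 19); (5, 18);
   (5, 17); (5, 3); (2, 17); (8, 22); (6, 3); (12, 19); (16, 19); (15, 18);
   (9, 4)].

Definition steps_M22 : seq (nat * nat * nat) :=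
  [:: (5, 68, 0); (9, 166, 0); (5, 8, 1); (6, 64, 1); (0, 50, 2); (5, 1, 2);
   (0, 19, 1); (9, 70, 1); (12, 15, 0); (0, 112, 1); (2, 107, 1); (7, 8, 0);
   (0, 56, 2); (1, 160, 1); (0, 109, 0); (2, 163, 1); (0, 21, 1); (1, 77, 1);
   (1, 7, 0); (3, 1, 0); (1, 141, 0); (11, 141, 0); (1, 31, 0); (12, 160, 0);
   (2, 141, 1); (3, 162, 1); (5, 45, 0); (3, 128, 0); (1, 87, 1); (16, 106,
   0); (2, 91, 0); (7, 64, 1); (2, 20, 1); (4, 68, 1); (2, 104, 0); (7, 42,
   1); (6, 68, 1); (16, 13, 0); (24, 70, 0); (3, 51, 0); (24, 143, 1); (13,
   76, 1); (7, 39, 1); (3, 83, 1); (3, 148, 2); (7, 147, 1); (4, 110, 1); (7,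
   7, 1); (4, 19, 0); (4, 43, 0); (3, 31, 0); (13, 19, 1); (7, 124, 0); (25,
   85, 1); (1, 59, 2); (15, 101, 0); (15, 135, 1); (5, 112, 1); (26, 33, 0);
   (25, 30, 0); (8, 60, 0); (26, 73, 0); (7, 160, 2); (26, 128, 0); (18, 128,
   0); (26, 85, 0); (3, 49, 2); (25, 133, 1); (19, 141, 2); (15, 27, 1); (3,
   105, 2); (25, 80, 2); (18, 93, 0); (18, 28, 1); (8, 5, 1); (5, 18, 1); (24,
   58, 1); (16, 122, 0); (15, 23, 0); (13, 129, 1); (5, 72, 1); (17, 127, 0);
   (18, 116, 0); (24, 83, 0); (8, 155, 0); (15, 119, 2); (14, 70, 2); (22, 85,
   0); (14, 91, 1); (15, 166, 0); (4, 44, 2); (24, 101, 0); (2, 61, 0); (17,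
   29, 0); (8, 64, 1); (20, 132, 2); (6, 34, 1); (8, 148, 1); (18, 35, 2);
   (10, 5, 1); (22, 8, 2); (22, 87, 2); (21, 41, 2); (25, 75, 0); (2, 32, 2);
   (15, 144, 1); (16, 101, 1); (8, 59, 1); (16, 67, 0); (12, 76, 0); (5, 13,
   1); (1, 71, 2); (22, 54, 0); (6, 131, 1); (6, 151, 1); (14, 119, 0); (9,
   102, 0); (11, 74, 2); (6, 35, 2); (26, 5, 2); (21, 150, 2); (24, 131, 0);
   (19, 132, 2); (6, 45, 0); (19, 44, 2); (4, 152, 2); (14, 88, 1); (12, 105,
   2); (18, 113, 2); (8, 102, 0); (15, 7, 2); (11, 144, 0); (19, 162, 0); (11,
   157, 0); (13, 149, 0); (23, 80, 0)].

Local Open Scope ag_scope.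

Lemma certified_L32 :
  certified els_C7 idcode [:: idcode] rels_C7 ycode defs_L32 steps_L32.
Proof. by vm_compute. Qed.

Lemma certified_M22 :
  certified els_L32 idcode (map word_code words_A4) rels_L32 tcode defs_M22 steps_M22.
Proof. by vm_compute. Qed.

(** * The two enumerations *)

Section Certified.
Variables (G : absGroup) (cd : G -> code) (x y t : G).
Hypothesis cdM : forall u v, cd (u * v) = cmul (cd u) (cd v).
Hypothesis cdV : forall u, cd u^-1 = cinv (cd u).
Hypothesis cd1 : cd 1 = idcode.
Hypotheses (cdx : cd x = xcode) (cdy : cd y = ycode) (cdt : cd t = tcode).
Hypothesis xyt_rels : calG_rels x y t.
Local Notation ev := (eval x y t).

Lemma cd_eval w : cd (ev w) = word_code w.
Proof. by elim: w => //= l w <-; rewrite cdM; case: l; rewrite /= ?cdx ?cdy ?cdt. Qed.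

Let x7 : x ^+ 7 = 1. Proof. by case: xyt_rels => -[]. Qed.
Let y2 : y * y = 1. Proof. by case: xyt_rels => -[_ []]; rewrite /= agg1. Qed.
Let t2 : t * t = 1.
Proof. by case: xyt_rels => -[_ [_ [_ [_ []]]]]; rewrite /= agg1. Qed.
Let xV : x^-1 = x ^+ 6. Proof. by apply: ag_invE; have := x7. Qed.
Let x2V : (x ^+ 2)^-1 = x ^+ 5. Proof. by apply: ag_invE; rewrite -ag_expD. Qed.

(** * The base of the climb: the cyclic group [<x>] *)

Definition in_C7 (u : G) : Prop := exists n, u = x ^+ n.

Lemma in_C7_small u : in_C7 u -> exists2 n, n < 7 & u = ev (nseq n X).
Proof.
by case=> n ->; exists (n %% 7); rewrite ?ltn_mod // eval_nseq /= ag_exp_mod.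
Qed.

Lemma in_C7_1 : in_C7 1. Proof. by exists 0. Qed.

Lemma in_C7_M u v : in_C7 u -> in_C7 v -> in_C7 (u * v).
Proof. by case=> m -> [n ->]; exists (m + n)%N; rewrite ag_expD. Qed.

Lemma in_C7_V u : in_C7 u -> in_C7 u^-1.
Proof.
case=> n ->; exists (n * 6)%N; apply: ag_invE.
by rewrite -ag_expD -mulnS mulnC ag_expM x7 ag_exp1n.
Qed.

(** Since [x^7 = 1], only seven powers occur, and their permutations are checked to be nontrivial
    except for exponent 0. *)
Lemma in_C7_inj u : in_C7 u -> cd u = cd 1 -> u = 1.
Proof.
case/in_C7_small=> n n7 ->; rewrite cd_eval cd1 => /eqP.
have /allP/(_ n) :
    all (fun n => (word_code (nseq n X) == idcode) ==> (n == 0)) (iota 0 7).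
  by vm_compute.
by rewrite mem_iota => /(_ n7)/implyP H /H/eqP->.
Qed.

Definition el_C7 (p : code) : G := ev (nseq (index p els_C7) X).

Lemma in_C7_el p : in_C7 (el_C7 p).
Proof. by exists (index p els_C7); rewrite /el_C7 eval_nseq. Qed.

Lemma cd_el_C7 : {in els_C7, forall p, cd (el_C7 p) = p}.
Proof.
move=> p pe; rewrite cd_eval -[RHS](nth_index idcode pe).
move: pe; rewrite -index_mem size_map size_iota; move: (index _ _) => i i7.
by rewrite (nth_map 0) ?size_iota // nth_iota.
Qed.

Lemma els_C7_cd u : in_C7 u -> cd u \in els_C7.
Proof.
case/in_C7_small=> n n7 ->; rewrite cd_eval.
by apply: (map_f (fun n => word_code (nseq n X))); rewrite mem_iota.
Qed.

Let el_cd_C7 := el_cd cdM in_C7_M in_C7_V in_C7_inj in_C7_el cd_el_C7 els_C7_cd.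

Lemma rels_C7P :
  {in rels_C7, forall l, {subset l <= els_C7} /\ rel_word el_C7 y l = 1}.
Proof.
have [[_ [_ [xy3 [xy4 _]]]] _ _ _] := xyt_rels.
have el_X n : el_C7 (word_code (nseq n X)) = x ^+ n.
  by rewrite -cd_eval el_cd_C7 ?eval_nseq //; exists n.
move=> l; rewrite !inE => /orP[]/eqP->; split; try by apply/allP; vm_compute.
  rewrite rel_word_flatten /rel_word /foldr el_X agg1 [x ^+ 1%N]agg1.
  exact: ag_exp_rotate.
rewrite rel_word_flatten /rel_word /foldr !el_X agg1 -xV [x ^+ 1%N]agg1.
(* As [y] is an involution, [[x,y]] is [x^-1 y x y]; the rotation moves [x^-1] to the end. *)
move: xy4; rewrite /ag_comm (ag_invE y2) => /ag_exp_rotate.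
by rewrite -!agA.
Qed.

(** * First step: L3(2), generated by [x] and [y] *)

Definition in_L32 : G -> Prop := adjoin in_C7 y.

Lemma in_L32_1 : in_L32 1. Proof. exact: adjoin1. Qed.

Lemma in_L32_M u v : in_L32 u -> in_L32 v -> in_L32 (u * v).
Proof. exact: adjoin_mul. Qed.

Lemma in_L32_V u : in_L32 u -> in_L32 u^-1.
Proof. by apply: adjoin_inv => //; apply: in_C7_V. Qed.

Lemma in_L32_inj u : in_L32 u -> cd u = cd 1 -> u = 1.
Proof.
apply: (adjoin_cd_inj cdM cdV in_C7_1 in_C7_M in_C7_V in_C7_inj in_C7_el
  cd_el_C7 els_C7_cd (B := [:: idcode]) y2 _ rels_C7P).
- move=> p; rewrite inE => /eqP->; exists 1; split=> //; first exact: in_C7_1.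
  by rewrite ag1g agg1.
- by rewrite cd1 cdy; exact: certified_L32.
Qed.

Lemma in_L32_eval w : all not_t w -> in_L32 (ev w).
Proof.
elim: w => [_|l w IH /= /andP[lT /IH wL]]; first exact: in_L32_1.
apply: in_L32_M => //; case: l lT => // _; last exact: adjoin_tau.
by apply: adjoin_sub; exists 1%N; rewrite /= agg1.
Qed.

Definition el_L32 (p : code) : G := ev (nth [::] words_L32 (index p els_L32)).

Lemma in_L32_el p : in_L32 (el_L32 p).
Proof.
apply: in_L32_eval.
case: (ltnP (index p els_L32) (size words_L32)) => [lt|/(nth_default [::])->//].
have /allP : all (all not_t) words_L32 by vm_compute.
by move=> H; apply/H/mem_nth.
Qed.

Lemma cd_el_L32 : {in els_L32, forall p, cd (el_L32 p) = p}.
Proof.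
move=> p pe; rewrite cd_eval -[RHS](nth_index idcode pe).
by rewrite (nth_map [::]) // -(size_map word_code) index_mem.
Qed.

(** Since [adjoin] grows on the right, closure under right multiplication by [y] and the powers of
    [x] confines all codes of [in_L32] to the 168 listed ones. *)
Lemma els_L32_closed : (idcode \in els_L32) &&
  all (fun p => all (fun q => cmul p q \in els_L32) (ycode :: els_C7)) els_L32.
Proof. by vm_compute. Qed.

Lemma els_L32_cd u : in_L32 u -> cd u \in els_L32.
Proof.
have /andP[one /allP cl] := els_L32_closed.
elim=> [|v1 v2 _ D Nv|v1 _ D]; first by rewrite cd1.
  rewrite cdM; have /allP := cl _ D; apply.
  by rewrite inE els_C7_cd ?orbT.
by rewrite cdM cdy; have /allP := cl _ D; apply; rewrite mem_head.
Qed.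

Let el_cd_L32 := el_cd cdM in_L32_M in_L32_V in_L32_inj in_L32_el cd_el_L32 els_L32_cd.

Lemma rels_L32P :
  {in rels_L32, forall l, {subset l <= els_L32} /\ rel_word el_L32 t l = 1}.
Proof.
have [_ r1 r2 r3] := xyt_rels.
have el_w w : all not_t w ->
    el_L32 (word_code w) = ev w.
  by move=> wL; rewrite -cd_eval el_cd_L32 //; apply: in_L32_eval.
have one n w : all not_t w ->
    (t * ev w) ^+ n = 1 ->
    {subset flatten (nseq n [:: word_code w]) <= els_L32} /\
    rel_word el_L32 t (flatten (nseq n [:: word_code w])) = 1.
  move=> wL E; split; last by rewrite rel_word_flatten /rel_word /foldr el_w // agg1.
  move=> p /flattenP[l /nseqP[-> _]]; rewrite inE => /eqP->.
  by rewrite -cd_eval els_L32_cd //; apply: in_L32_eval.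
move=> l; rewrite !inE => /or3P[]/eqP->; apply: one => //.
- rewrite eval_cat -cat1s eval_cat !eval_nseq.
  move: r1; rewrite /ag_conj agA x2V => /ag_exp_rotate.
  by rewrite /= !agg1 -!agA.
(* [x^2 t^x = x t x], so the relator is a power of [(xyx)(tx)], which rotates to [t] followed by
   [xxyx]. *)
- have E : x * (y * (x ^+ 2 * ag_conj t x)) = (x * (y * x)) * (t * x).
    by rewrite /ag_conj /= agg1 -!agA (agA x x^-1) ag_mulgV ag1g.
  move: r2; rewrite E => /ag_exp_rotate.
  by rewrite -(agA t) [ev _]/= agg1.
- by rewrite [ev _]agg1; apply: ag_exp_rotate.
Qed.

Lemma words_A4_comm :
  {in map word_code words_A4, forall p,
    exists u, [/\ in_L32 u, cd u = p & u * t = t * u]}.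
Proof.
have [[_ [_ [_ [_ [_ [xt_comm yt_comm]]]]]] _ _ _] := xyt_rels.
have zt : ev (nseq 2 X ++ Y :: nseq 4 X) * t = t * ev (nseq 2 X ++ Y :: nseq 4 X).
  have -> : ev (nseq 2 X ++ Y :: nseq 4 X) = x ^+ 2 * (y * x^-1) * (x ^+ 2)^-1.
    rewrite eval_cat [ev (Y :: _)]/(y * ev (nseq 4 X)) !eval_nseq.
    rewrite -(agA (x ^+ 2)) -(agA y).
    (* [x^-1 x^-2] is [x^(6+5)], and 11 reduces to 4 modulo 7. *)
    by rewrite xV x2V -ag_expD -(ag_exp_mod (6 + 5) x7).
  exact: ag_comm_conj xt_comm.
have zit i : ev (flatten (nseq i (nseq 2 X ++ Y :: nseq 4 X))) * t =
             t * ev (flatten (nseq i (nseq 2 X ++ Y :: nseq 4 X))).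
  move: zt; move: (nseq 2 X ++ _) => z zt.
  elim: i => [|i IH]; first by rewrite ag1g agg1.
  have -> : flatten (nseq i.+1 z) = z ++ flatten (nseq i z) by [].
  by rewrite eval_cat -agA IH agA zt agA.
have wt w : w \in words_A4 -> ev w * t = t * ev w.
  rewrite mem_cat => /orP[/mapP[i _ ->]|/allpairsP[[i j] [_ _ ->]]]; first exact: zit.
  rewrite eval_cat -[ev (Y :: _)]/(y * ev (flatten (nseq j _))) -!agA zit.
  by rewrite (agA y) -(ag_commP yt_comm) -!agA (agA _ t) zit !agA.
move=> p /mapP[w wA ->]; exists (ev w); split; rewrite ?cd_eval ?wt //.
apply: in_L32_eval; have /allP : all (all not_t) words_A4.
  by vm_compute.
by apply.
Qed.

(** * Second step: the group generated by [x], [y] and [t] *)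

Definition in_G : G -> Prop := adjoin in_L32 t.

Lemma in_G_inj u : in_G u -> cd u = cd 1 -> u = 1.
Proof.
apply: (adjoin_cd_inj cdM cdV in_L32_1 in_L32_M in_L32_V in_L32_inj in_L32_el
  cd_el_L32 els_L32_cd t2 words_A4_comm rels_L32P).
rewrite cd1 cdt; exact: certified_M22.
Qed.

Lemma in_G_eval w : in_G (ev w).
Proof.
elim: w => [|l w IH]; first exact: adjoin1.
apply: adjoin_mul IH; case: l; last exact: adjoin_tau.
  by do 2 apply: adjoin_sub; exists 1%N; rewrite /= agg1.
by apply: adjoin_sub; apply: adjoin_tau.
Qed.

(** Injectivity is applied to [v w^-1], itself the value of a positive word. *)
Lemma eval_eq_of_code v w : cd (ev v) = cd (ev w) -> ev v = ev w.
Proof.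
move=> E; apply: (@ag_mulIg _ (ev w)^-1); rewrite ag_mulgV.
have y2' : y ^+ 2 = 1 by rewrite /= agg1.
have t2' : t ^+ 2 = 1 by rewrite /= agg1.
rewrite -{1}(eval_inv w x7 y2' t2') -eval_cat; apply: in_G_inj.
  exact: in_G_eval.
by rewrite eval_cat cdM E -cdM eval_inv // ag_mulgV.
Qed.
End Certified.

(** * Generators of M22 *)

Section Generators.
Local Open Scope group_scope.

(** These words in the ATLAS generators place the images of [x] and [t] in [M22]. *)
Definition m22x : {perm 'I_22} :=
  m22b * m22b * m22a * m22b * m22a * m22b * m22a * m22b * m22a * m22b * m22a *
  m22b * m22b * m22a * m22b * m22a * m22b * m22a * m22b.
Definition m22t : {perm 'I_22} :=
  m22b * m22a * m22b * m22b * m22b * m22a * m22b * m22b * m22b * m22a *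
  m22b * m22a * m22b * m22a * m22b * m22b * m22a * m22b * m22a * m22b * m22a *
  m22b * m22b * m22b * m22a * m22b * m22b * m22b * m22a * m22b.

Lemma pcode_m22x : pcode m22x = xcode.
Proof. by rewrite !pcodeM pcode_m22a pcode_m22b; vm_compute. Qed.

Lemma pcode_m22t : pcode m22t = tcode.
Proof. by rewrite !pcodeM pcode_m22a pcode_m22b; vm_compute. Qed.

Definition perm_group : absGroup := absGroup_of_fin {perm 'I_22}.

Definition m22_eval : word -> {perm 'I_22} := @eval perm_group m22x m22a m22t.

Lemma pcode_eval w : pcode (m22_eval w) = word_code w.
Proof.
elim: w => [|l w IH]; first exact: pcode1.
rewrite /m22_eval /= pcodeM IH; congr cmul.
by case: l; [exact: pcode_m22x | exact: pcode_m22a | exact: pcode_m22t].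
Qed.

Lemma m22_eval_cat v w : m22_eval (v ++ w) = m22_eval v * m22_eval w.
Proof. exact: (@eval_cat perm_group). Qed.

Lemma pcode_exp (u : perm_group) n :
  pcode (ag_exp u n) = iter n (cmul (pcode u)) idcode.
Proof. by elim: n => [|n IH]; [exact: pcode1 | rewrite iterS -IH; exact: pcodeM]. Qed.

Lemma m22_calG_rels : @calG_rels perm_group m22x m22a m22t.
Proof.
have cM (u v : perm_group) : pcode (ag_mul u v) = cmul (pcode u) (pcode v).
  exact: pcodeM.
have cV (u : perm_group) : pcode (ag_inv u) = cinv (pcode u) by exact: pcodeV.
have c1 : pcode (@ag_one perm_group) = idcode by exact: pcode1.
split; [do 6?split | | |]; apply: pcode_inj;
  rewrite /ag_comm /ag_conj ?(cM, cV, pcode_exp, pcode_m22x, pcode_m22a, pcode_m22t) c1;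
  by vm_compute.
Qed.

Lemma m22_gen : <<[set m22x; m22a; m22t]>> = M22.
Proof.
set H := <<_>>; have Hx : m22x \in H by rewrite mem_gen // !inE eqxx.
have Ha : m22a \in H by rewrite mem_gen // !inE eqxx orbT.
have Ht : m22t \in H by rewrite mem_gen // !inE eqxx !orbT.
have Hw w : m22_eval w \in H.
  elim: w => [|l w IH]; first exact: group1.
  by rewrite [m22_eval _]/(_ * _) groupM //; case: l.
have Ma : m22a \in M22 by rewrite mem_gen // !inE eqxx.
have Mb : m22b \in M22 by rewrite mem_gen // !inE eqxx orbT.
apply/eqP; rewrite eqEsubset !gen_subG; apply/andP; split; apply/subsetP => u.
  by rewrite !inE -orbA => /or3P[]/eqP->; rewrite // !groupM.
rewrite !inE => /orP[/eqP->|/eqP->] //.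
(* The converse inclusion needs [m22b] as a word in [x], [y], [t], verified on codes. *)
have -> : m22b = m22_eval [:: X; X; X; X; T; X; Y; X; T; X; X; T; X; T; X; X; Y; X].
  by apply: pcode_inj; rewrite pcode_eval pcode_m22b; vm_compute.
exact: Hw.
Qed.

(** In a finite group, generated elements are products of generators without inverses. *)
Lemma m22_eval_surj u : u \in M22 -> exists w, m22_eval w = u.
Proof.
rewrite -m22_gen => /gen_prodgP[n [c cA ->]].
elim: n c cA => [|n IH] c cA; first by exists [::]; rewrite big_ord0.
have [i|w Ew] := IH (fun i => c (lift ord0 i)); first exact: cA.
have [v Ev] : exists v, m22_eval v = c ord0.
  have := cA ord0; rewrite !inE -orbA => /or3P[]/eqP->;
    by [exists [:: X]; rewrite /m22_eval /= mulg1
      | exists [:: Y]; rewrite /m22_eval /= mulg1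
      | exists [:: T]; rewrite /m22_eval /= mulg1].
by exists (v ++ w); rewrite m22_eval_cat big_ord_recl Ev Ew.
Qed.
End Generators.

(** * The homomorphism from [M22] to a group satisfying the relations *)

Section Factorisation.
Variables (K : absGroup) (x y t : K).
Hypothesis xyt_rels : calG_rels x y t.

Let G := prod_group perm_group K.
Let cd (g : G) : code := pcode g.1.

Lemma eval_prod w :
  @eval G (m22x, x) (m22a, y) (m22t, t) w = (m22_eval w, eval x y t w).
Proof. by elim: w => //= l w ->; case: l. Qed.

(** In the subgroup of the product generated by the three pairs, the first component determines the
    element; the second components are then compared. *)
Lemma m22_eval_factor v w : m22_eval v = m22_eval w -> eval x y t v = eval x y t w.
Proof.
move=> E; suff: @eval G (m22x, x) (m22a, y) (m22t, t) v =
                    @eval G (m22x, x) (m22a, y) (m22t, t) w.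
  by rewrite !eval_prod => -[].
apply: (@eval_eq_of_code G cd).
- by move=> g h; exact: pcodeM.
- by move=> g; exact: pcodeV.
- exact: pcode1.
- exact: pcode_m22x.
- exact: pcode_m22a.
- exact: pcode_m22t.
- exact: prod_calG_rels m22_calG_rels xyt_rels.
by rewrite /cd !eval_prod /= E.
Qed.

Lemma m22_hom : exists f : {perm 'I_22} -> K,
  [/\ {in M22 &, forall u v, f (u * v)%g = f u * f v},
      f m22x = x, f m22a = y & f m22t = t].
Proof.
(* A word is chosen for each permutation, by choice over a finite type; outside [M22] it is the
   empty word. The map evaluates that word in [K], and any other word for the same permutation gives
   the same value. *)
have [word_of wE] : exists word_of : {perm 'I_22} -> word,
    forall u, u \in M22 -> m22_eval (word_of u) = u.
  apply: (@fin_all_exists _ (fun=> word)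
    (fun u w => u \in M22 -> m22_eval w = u)) => u.
  case: (boolP (u \in M22)) => [/m22_eval_surj[w <-]|_].
    by exists w.
  by exists [::].
have fE w u : u = m22_eval w -> u \in M22 -> eval x y t (word_of u) = eval x y t w.
  by move=> E uM; apply: m22_eval_factor; rewrite wE.
have genM u : u \in [set m22x; m22a; m22t] -> u \in M22.
  by move=> uA; rewrite -m22_gen mem_gen.
exists (fun u => eval x y t (word_of u)); split.
- move=> u v uM vM; rewrite -eval_cat; apply: fE; last exact: groupM.
  by rewrite m22_eval_cat !wE.
- rewrite (fE [:: X]) ?genM ?inE ?eqxx //=; first by rewrite agg1.
  by rewrite /m22_eval /= mulg1.
- rewrite (fE [:: Y]) ?genM ?inE ?eqxx ?orbT //=; first by rewrite agg1.
  by rewrite /m22_eval /= mulg1.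
- rewrite (fE [:: T]) ?genM ?inE ?eqxx ?orbT //=; first by rewrite agg1.
  by rewrite /m22_eval /= mulg1.
Qed.
End Factorisation.

Theorem mainTheorem1 :
  (exists x y t : {perm 'I_22}, presents M22 x y t calG_rels) /\
  (exists x y t : {perm 'I_22},
     (<<[set x; y; t]>> = M22)%g /\ @progenitor_rels (absGroup_of_fin {perm 'I_22}) x y t).
Proof.
split; exists m22x, m22a, m22t; split; try exact: m22_gen.
- exact: m22_calG_rels.
- by move=> K x y t; apply: m22_hom.
by case: m22_calG_rels.
Qed.
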